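(* Let a Boolean control network $x(t+1)=Lu(t)x(t)$, $y(t)=Hx(t)$ be given, with weighted pair graph $\mathcal{G}=(\mathcal{V},\mathcal{E},\mathcal{W})$. The network is not Type-1 observable if and only if there is a state $\delta_N^i$ occurring in some non-diagonal vertex of $\mathcal{G}$ such that the deterministic finite automaton $A_{\delta_N^i}$ recognizes the language $(\Delta_M)^*$ of all finite words over $\Delta_M$.
   Context: Fix positive integers $n,m,q$ and put $N=2^n$, $M=2^m$, $Q=2^q$. For a positive integer $k$, $\delta_k^i$ is the $i$-th column of the identity matrix $I_k$ and $\Delta_k=\{\delta_k^1,\dots,\delta_k^k\}$. A logical matrix of size $k\times s$ is one all of whose columns lie in $\Delta_k$. A Boolean control network (BCN, in algebraic form) is a system $x(t+1)=Lu(t)x(t)$, $y(t)=Hx(t)$, $t=0,1,2,\dots$, with states $x(t)\in\Delta_N$, inputs $u(t)\in\Delta_M$, outputs $y(t)\in\Delta_Q$, where $L$ is an $N\times NM$ logical matrix and $H$ is a $Q\times N$ logical matrix. Products are semi-tensor products; concretely $Lux=L(u\otimes x)$ for $u\in\Delta_M$, $x\in\Delta_N$, with $\otimes$ the Kronecker product. For $x_0\in\Delta_N$, $p\ge 1$ and $U=u_0\cdots u_{p-1}\in(\Delta_M)^p$, put $x_{t+1}=Lu_tx_t$ for $0\le t<p$ and $(HL)_{x_0}^p(U)=(Hx_1)\cdots(Hx_p)\in(\Delta_Q)^p$. Type-1 observability: for every $x_0\in\Delta_N$ there exist $p\ge1$ and $U\in(\Delta_M)^p$ such that for all $\bar x_0\in\Delta_N$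 with $\bar x_0\ne x_0$, $Hx_0=H\bar x_0$ implies $(HL)_{x_0}^p(U)\neq(HL)_{\bar x_0}^p(U)$. Weighted pair graph $\mathcal{G}=(\mathcal{V},\mathcal{E},\mathcal{W})$: $\mathcal{V}$ is the set of unordered pairs $(x,x')$ (so $(x,x')=(x',x)$, and $x=x'$ is allowed) of elements of $\Delta_N$ with $Hx=Hx'$. For vertices $v=(x_1,x_1')$, $w=(x_2,x_2')$, let $\mathcal{W}((v,w))$ be the set of $u\in\Delta_M$ such that ($Lux_1=x_2$ and $Lux_1'=x_2'$) or ($Lux_1=x_2'$ and $Lux_1'=x_2$). The directed edge $(v,w)$ belongs to $\mathcal{E}$ iff this set is nonempty, and then it is the weight of the edge. A vertex $(x,x)$ is called diagonal; the other vertices are non-diagonal. A deterministic finite automaton (DFA) is $A=(S,\Sigma,\sigma,s_0,F)$ with finite state set $S$, finite nonempty alphabet $\Sigma$, initial state $s_0\in S$, final states $F\subset S$, and a partial transition function $\sigma:S\times\Sigma\to S$, extended naturally to a partial function $S\times\Sigma^*\to S$, where $\Sigma^*$ is the set of all finite words including the empty word. The language recognized by $A$ is $L(A)=\{w\in\Sigma^*\mid \sigma(s_0,w)\text{ is defined and lies in }F\}$. The DFA $A_{\delta_N^i}$: its alphabet is $\Delta_M$; its states are subsets of $\mathcal{V}$; its initial state $s_0$ is the set of all non-diagonal vertices of $\mathcal{V}$ containing $\delta_N^i$. For a state $s$ and a letter $\delta_M^j$, let $s'=\{v\in\mathcal{V}\mid \text{there is } v'\in s\text{ with }(v',v)\in\mathcal{E}\text{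 and }\delta_M^j\in\mathcal{W}((v',v))\}$; if $s'\neq\emptyset$ then the transition function at $(s,\delta_M^j)$ takes the value $s'$, and otherwise it is undefined there. The state set consists of $s_0$ and all sets obtained from $s_0$ by repeatedly applying these transitions. All states are final. *)

(* Defs.v *)
From HB Require Import structures.
From mathcomp Require Import all_boot all_order all_algebra.
From mathcomp Require Import mxtens.

Set Implicit Arguments.
Unset Strict Implicit.
Unset Printing Implicit Defensive.

Import GRing.Theory.

Local Open Scope ring_scope.

(* Matrices with 0/1 entries are taken over [int].  [delta k i] is the vector
   written delta_k^(i+1) when columns are numbered from 1. *)
Definition Delta_seq (k : nat) : seq 'cV[int]_k :=
  [seq col i (1%:M : 'M[int]_k) | i : 'I_k].

(* [seq_sub] makes the set of columns of the identity a finite type; the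
   underlying column vector of [x : Delta k] is [val x]. *)
Definition Delta (k : nat) : finType := seq_sub (Delta_seq k).

Lemma delta_subproof (k : nat) (i : 'I_k) :
  col i (1%:M : 'M[int]_k) \in Delta_seq k.
Proof. exact: image_f. Qed.

Definition delta (k : nat) (i : 'I_k) : Delta k := SeqSub (delta_subproof i).

Definition logical (k s : nat) (A : 'M[int]_(k, s)) : Prop :=
  forall j : 'I_s, col j A \in Delta_seq k.

Record bcn (n m q : nat) := Bcn {
  bcnL : 'M[int]_(2 ^ n, 2 ^ m * 2 ^ n);
  bcnH : 'M[int]_(2 ^ q, 2 ^ n);
  bcnL_logical : logical bcnL;
  bcnH_logical : logical bcnH
}.

Lemma logical_mul (k s : nat) (A : 'M[int]_(k, s)) (x : 'cV[int]_s) :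
  logical A -> x \in Delta_seq s -> A *m x \in Delta_seq k.
Proof. by move=> hA /imageP[i _ ->]; rewrite colE mul1mx -colE; apply: hA. Qed.

(* The semi-tensor product of two column vectors is their Kronecker product;
   its type has 1 * 1 columns, which is convertible to 1. *)
Definition stp_col (k s : nat) (u : 'cV[int]_k) (x : 'cV[int]_s) :
  'cV[int]_(k * s) := u *t x.

Lemma stp_col_Delta (k s : nat) (u : 'cV[int]_k) (x : 'cV[int]_s) :
  u \in Delta_seq k -> x \in Delta_seq s -> stp_col u x \in Delta_seq (k * s).
Proof.
move=> /imageP[i _ ->] /imageP[j _ ->]; apply/imageP.
exists (mxtens_index (i, j)) => //; apply/matrixP=> a b.
case: (mxtens_indexP a) => a1 a2.
rewrite !mxE mxtens_indexK /= (inj_eq (can_inj (@mxtens_indexK _ _))) xpair_eqE.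
by case: (a1 == i); case: (a2 == j).
Qed.

Section Network.

Context {n m q : nat} (S : bcn n m q).

Local Notation State := (Delta (2 ^ n)).
Local Notation Input := (Delta (2 ^ m)).
Local Notation Output := (Delta (2 ^ q)).

Lemma next_subproof (u : Input) (x : State) :
  bcnL S *m stp_col (val u) (val x) \in Delta_seq (2 ^ n).
Proof.
exact: logical_mul (bcnL_logical S) (stp_col_Delta (valP u) (valP x)).
Qed.

Definition next (u : Input) (x : State) : State := SeqSub (next_subproof u x).

Lemma out_subproof (x : State) : bcnH S *m val x \in Delta_seq (2 ^ q).
Proof. exact: logical_mul (bcnH_logical S) (valP x). Qed.

Definition out (x : State) : Output := SeqSub (out_subproof x).

(* [scanl] lists x_1, ..., x_p and omits x_0. *)
Definition HL (p : nat) (x0 : State) (U : p.-tuple Input) : p.-tuple Output :=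
  [tuple of map out (scanl (fun x u => next u x) x0 U)].

Definition type1_observable : Prop :=
  forall x0 : State, exists p : nat, exists U : p.-tuple Input,
    (1 <= p)%N /\
    forall xb0 : State, xb0 <> x0 -> out x0 = out xb0 -> HL x0 U <> HL xb0 U.

(* An unordered pair (x, x') is encoded as the set {x, x'}, which is a
   singleton when x = x'. *)
Definition upair (x x' : State) : {set State} := [set x; x'].

Definition vertices : {set {set State}} :=
  [set upair p.1 p.2 | p : State * State & out p.1 == out p.2].

Definition weight (v w : {set State}) : {set Input} :=
  [set u | [exists x1 : State, exists x1' : State,
            exists x2 : State, exists x2' : State,
     [&& v == upair x1 x1', w == upair x2 x2' &
         ((next u x1 == x2) && (next u x1' == x2'))
         || ((next u x1 == x2') && (next u x1' == x2))]]].

Definition edges : {set {set State} * {set State}} :=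
  [set e | [&& e.1 \in vertices, e.2 \in vertices & weight e.1 e.2 != set0]].

Definition diagonal (v : {set State}) : bool := [exists x, v == upair x x].

End Network.

Record dfa (Sigma : finType) := Dfa {
  dfa_state : finType;
  dfa_alphabet_nonempty : (0 < #|Sigma|)%N;
  dfa_trans : dfa_state -> Sigma -> option dfa_state;
  dfa_init : dfa_state;
  dfa_final : {set dfa_state}
}.

Fixpoint dfa_run (Sigma : finType) (A : dfa Sigma) (s : dfa_state A)
    (w : seq Sigma) : option (dfa_state A) :=
  if w is a :: w' then
    if dfa_trans s a is Some s' then dfa_run s' w' else None
  else Some s.

Definition dfa_lang (Sigma : finType) (A : dfa Sigma) : pred (seq Sigma) :=
  fun w => if dfa_run (dfa_init A) w is Some s then s \in dfa_final A
           else false.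

Definition recognizes (Sigma : finType) (A : dfa Sigma)
    (K : pred (seq Sigma)) : Prop := dfa_lang A =i K.

Section ObservabilityAutomaton.

Context {n m q : nat} (S : bcn n m q).

Local Notation State := (Delta (2 ^ n)).
Local Notation Input := (Delta (2 ^ m)).

Definition post (s : {set {set State}}) (u : Input) : {set {set State}} :=
  [set v in vertices S | [exists v' in s,
     ((v', v) \in edges S) && (u \in weight S v' v)]].

Definition init_set (i : 'I_(2 ^ n)) : {set {set State}} :=
  [set v in vertices S | ~~ diagonal v & delta i \in v].

Definition post_rel : rel {set {set State}} :=
  fun s s' => (s' != set0) && [exists u : Input, s' == post s u].

Definition reachable (i : 'I_(2 ^ n)) : pred {set {set State}} :=
  connect post_rel (init_set i).

Definition A_state (i : 'I_(2 ^ n)) : finType :=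
  {s : {set {set State}} | reachable i s}.

Lemma reachable_init (i : 'I_(2 ^ n)) : reachable i (init_set i).
Proof. exact: connect0. Qed.

Lemma reachable_post (i : 'I_(2 ^ n)) (s : {set {set State}}) (u : Input) :
  reachable i s -> post s u != set0 -> reachable i (post s u).
Proof.
move=> hs hne; apply: connect_trans hs (connect1 _).
by rewrite /post_rel hne; apply/existsP; exists u.
Qed.

Definition A_trans (i : 'I_(2 ^ n)) (s : A_state i) (u : Input) :
    option (A_state i) :=
  if @idP (post (val s) u != set0) is ReflectT hne
  then Some (Sub (post (val s) u) (reachable_post (valP s) hne))
  else None.

Lemma Input_nonempty : (0 < #|Input|)%N.
Proof.
have h : (0 < 2 ^ m)%N by rewrite expn_gt0.
by apply/card_gt0P; exists (delta (Ordinal h)).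
Qed.

Definition A_delta (i : 'I_(2 ^ n)) : dfa Input :=
  @Dfa Input (A_state i) Input_nonempty (@A_trans i)
       (Sub (init_set i) (reachable_init i)) setT.

End ObservabilityAutomaton.

(* Main.v *)
Require Import Defs.
From HB Require Import structures.
From mathcomp Require Import all_boot all_order all_algebra.
From Stdlib Require Import Classical.

Set Implicit Arguments.
Unset Strict Implicit.
Unset Printing Implicit Defensive.

(** The state that the automaton [A_delta S i] reaches on a word [w] collects
    the pairs of states into which [w] drives the pairs {delta i, xb} with
    xb distinct from delta i, provided that both trajectories have produced the
    same outputs throughout.  A run gets stuck exactly when this collection
    becomes empty, so [w] is accepted exactly when some xb remains confusable
    with delta i under [w] (lemma [A_delta_lang]).  On the other side,
    observability says that every state x0 has one word under which no other
    state is confusable with it (lemma [type1_observableP]).  The theorem is the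
    negation of the latter, read through the former.

    Two discrepancies at the empty word have to be reconciled.  Observability
    asks for a word of positive length, which is harmless because confusability
    can only be lost when a word is extended.  The automaton always accepts the
    empty word, whereas a state is confusable under it exactly when the state
    lies in a non-diagonal vertex; hence the first clause in the right-hand side
    of the equivalence. *)

Local Notation next := Defs.next.

Section PairDynamics.

Context {n m q : nat} (S : bcn n m q).

Local Notation State := (Delta (2 ^ n)).
Local Notation Input := (Delta (2 ^ m)).
Implicit Types (x y : State) (u : Input) (w : seq Input).

Lemma delta_surj (x : State) : exists i, x = delta i.
Proof.
by case: x => v hv; have /imageP[i _ e] := hv; exists i; apply: val_inj.
Qed.

(** This is [HL] without the length index, so that it can be analysed by
    induction on the input word. *)
Definition trace x w : seq (Delta (2 ^ q)) :=
  [seq out S y | y <- scanl (fun y u => next S u y) x w].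

Lemma HL_eqE (p : nat) x y (U : p.-tuple Input) :
  (HL S x U == HL S y U) = (trace x U == trace y U).
Proof. by []. Qed.

Lemma trace_cons_eqP u w x y :
  trace x (u :: w) = trace y (u :: w) <->
  out S (next S u x) = out S (next S u y)
  /\ trace (next S u x) w = trace (next S u y) w.
Proof.
rewrite /trace /=; split=> [/eqP|[-> ->] //].
by rewrite eqseq_cons => /andP[/eqP-> /eqP->].
Qed.

Definition confusable x w : bool :=
  [exists y, [&& y != x, out S x == out S y & trace x w == trace y w]].

Lemma confusable_nil x w : confusable x w -> confusable x [::].
Proof.
by case/existsP=> y /and3P[ne eo _]; apply/existsP; exists y; rewrite ne eo /=.
Qed.

(** The word [w] may be empty here: any letter can be appended to an empty
    word that separates, by [confusable_nil]. *)
Lemma type1_observableP :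
  type1_observable S <-> forall x, exists w, ~~ confusable x w.
Proof.
split=> obs x.
  have [p [U [_ sepU]]] := obs x; exists U; apply/negP=> /existsP[y].
  case/and3P=> /eqP ne /eqP eo; rewrite -HL_eqE => /eqP.
  exact: sepU ne eo.
have [w sepw] := obs x.
have [w' w'_gt0 sepw'] : exists2 w', 0 < size w' & ~~ confusable x w'.
  case: w sepw => [|u w] sepw; last by exists (u :: w).
  have /card_gt0P[u _] := @Input_nonempty m.
  by exists [:: u] => //; apply: contra sepw; apply: confusable_nil.
exists (size w'), (in_tuple w'); split=> // y /eqP ne /eqP eo /eqP.
rewrite HL_eqE => et; case/negP: sepw'; apply/existsP; exists y.
by rewrite ne eo.
Qed.

Lemma upairC x y : upair x y = upair y x.
Proof. exact: setUC. Qed.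

Lemma upair_eq x x' y y' :
  upair x x' = upair y y' -> (x = y /\ x' = y') \/ (x = y' /\ x' = y).
Proof.
move=> e.
have: x \in upair y y' by rewrite -e set21.
have: x' \in upair y y' by rewrite -e set22.
have: y \in upair x x' by rewrite e set21.
have: y' \in upair x x' by rewrite e set22.
rewrite !in_set2.
by move=> /orP[]/eqP h1 /orP[]/eqP h2 /orP[]/eqP h3 /orP[]/eqP h4; subst; auto.
Qed.

Lemma upair_vertex x x' : (upair x x' \in vertices S) = (out S x == out S x').
Proof.
apply/imsetP/idP => [[[y y'] /=]|eo]; last by exists (x, x'); rewrite ?inE.
by rewrite inE /= => eo /upair_eq[[-> ->]|[-> ->]] //; rewrite eq_sym.
Qed.

Lemma upair_diagonal x x' : diagonal (upair x x') = (x == x').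
Proof.
apply/existsP/eqP => [[y /eqP/upair_eq[[-> ->]|[-> ->]]] //|->].
by exists x'.
Qed.

(** The two orders in which the successors may be matched with the endpoints of
    [v'] are one condition on unordered pairs, so the letter [u] relates each
    pair to a single pair, its image under the componentwise map [next S u]. *)
Lemma weightP u (v v' : {set State}) :
  reflect (exists x x', v = upair x x' /\ v' = upair (next S u x) (next S u x'))
          (u \in weight S v v').
Proof.
rewrite inE; apply: (iffP idP) => [|[x [x' [-> ->]]]].
  case/existsP=> x /existsP[x' /existsP[y /existsP[y' /and3P[/eqP-> /eqP->]]]].
  by case/orP=> /andP[/eqP<- /eqP<-]; exists x, x'; split; rewrite 1?upairC.
apply/existsP; exists x; apply/existsP; exists x'.
apply/existsP; exists (next S u x); apply/existsP; exists (next S u x').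
by rewrite !eqxx.
Qed.

(** In the forward direction the equality of the successors' outputs is the
    requirement that [v] be a vertex: a pair leaves the graph as soon as its
    outputs differ. *)
Lemma postP (s : {set {set State}}) u (v : {set State}) :
  s \subset vertices S ->
  reflect (exists x x', [/\ upair x x' \in s,
                            v = upair (next S u x) (next S u x')
                          & out S (next S u x) = out S (next S u x')])
          (v \in post S s u).
Proof.
move=> /subsetP sV; rewrite inE; apply: (iffP andP).
  case=> vV /existsP[v' /andP[v's /andP[_ /weightP[x [x' [ev' ev]]]]]].
  exists x, x'; rewrite -ev'; split=> //.
  by apply/eqP; rewrite -upair_vertex -ev.
move=> [x [x' [xs -> eo]]]; split; first by rewrite upair_vertex eo.
have uw :
    u \in weight S (upair x x') (upair (next S u x) (next S u x')).
  by apply/weightP; exists x, x'.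
apply/existsP; exists (upair x x'); rewrite xs uw inE /= sV // upair_vertex eo.
by rewrite eqxx andbT; apply/set0Pn; exists u.
Qed.

Lemma post_sub (s : {set {set State}}) u : post S s u \subset vertices S.
Proof. by apply/subsetP=> v; rewrite inE; case/andP. Qed.

End PairDynamics.

Section Automaton.

Context {n m q : nat} (S : bcn n m q) (i : 'I_(2 ^ n)).

Local Notation State := (Delta (2 ^ n)).
Local Notation Input := (Delta (2 ^ m)).

Lemma A_transE (s : dfa_state (A_delta S i)) (u : Input) :
  omap val (dfa_trans s u)
    = if post S (val s) u != set0 then Some (post S (val s) u) else None.
Proof.
rewrite /= /A_trans; case: {-}_ / idP => [h|/negP/negbTE->] //.
by rewrite (h : post S (val s) u != set0).
Qed.

(** Each letter of [w] either keeps a pair in the graph, when both outputs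
    agree, or discards it; a surviving run is thus one for which some pair of
    [val s] yields equal traces, by induction on [w] for all states [s] at once.
    The set [val s] is required to be nonempty because the empty word never
    gets stuck, even at the empty set of pairs. *)
Lemma A_delta_runP (w : seq Input) (s : dfa_state (A_delta S i)) :
  val s \subset vertices S -> val s != set0 ->
  reflect (exists x x', upair x x' \in val s /\ trace S x w = trace S x' w)
          (dfa_run s w).
Proof.
elim: w s => [|u w IHw] s sV s_neq0.
  apply: ReflectT; have /set0Pn[v vs] := s_neq0.
  have /imsetP[[x x'] _ ev] := subsetP sV _ vs.
  by exists x, x'; rewrite -ev.
have -> : dfa_run s (u :: w) = obind (fun s' => dfa_run s' w) (dfa_trans s u).
  by [].
have := A_transE s u.
case: ifPn => [post_neq0|post_eq0]; case: (dfa_trans s u) => [s'|] //;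
  last first.
  move=> _; apply: ReflectF => -[x [x' [xs /trace_cons_eqP[eo _]]]].
  move/negPn/eqP: post_eq0 => post_eq0.
  have : upair (next S u x) (next S u x') \in post S (val s) u.
    by apply/(postP _ _ sV); exists x, x'.
  by rewrite post_eq0 inE.
move=> /Some_inj es'.
have s'V : val s' \subset vertices S by rewrite es' post_sub.
have s'_neq0 : val s' != set0 by rewrite es'.
apply: (iffP (IHw s' s'V s'_neq0)).
  case=> y [y' []]; rewrite es' => /(postP _ _ sV)[x [x' [xs e eo]]] et.
  exists x, x'; split=> //; apply/trace_cons_eqP; split=> //.
  (* The representatives y, y' may be the successors in swapped order; equality
     of traces is symmetric. *)
  by case/upair_eq: e et => [[-> ->]|[-> ->]].
case=> x [x' [xs /trace_cons_eqP[eo et]]].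
exists (next S u x), (next S u x'); split=> //.
by rewrite es'; apply/(postP _ _ sV); exists x, x'.
Qed.

Lemma upair_init (x x' : State) :
  (upair x x' \in init_set S i)
    = [&& out S x == out S x', x != x' & (delta i == x) || (delta i == x')].
Proof. by rewrite inE upair_vertex upair_diagonal in_set2. Qed.

Lemma init_sub : init_set S i \subset vertices S.
Proof. by apply/subsetP=> v; rewrite inE; case/andP. Qed.

Lemma init_neq0P :
  reflect (exists v, v \in vertices S /\ ~~ diagonal v /\ delta i \in v)
          (init_set S i != set0).
Proof.
apply: (iffP (set0Pn _)) => [[v]|[v [vV [vD iv]]]].
  by rewrite inE => /and3P[]; exists v.
by exists v; rewrite inE vV vD.
Qed.

Lemma confusableP (w : seq Input) :
  reflect (exists x x', upair x x' \in init_set S i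
                        /\ trace S x w = trace S x' w)
          (confusable S (delta i) w).
Proof.
apply: (iffP existsP) => [[y /and3P[ne eo /eqP et]]|[x [x' []]]].
  by exists (delta i), y; rewrite upair_init eo eq_sym ne eqxx.
rewrite upair_init => /and3P[eo ne /orP[]/eqP ei] et; rewrite ei.
  by exists x'; rewrite eq_sym ne eo et eqxx.
by exists x; rewrite ne eq_sym eo et eqxx.
Qed.

Lemma confusable_init (w : seq Input) :
  confusable S (delta i) w -> init_set S i != set0.
Proof.
by case/confusableP=> x [x' [xi _]]; apply/set0Pn; exists (upair x x').
Qed.

Lemma A_delta_lang (w : seq Input) :
  init_set S i != set0 ->
  (w \in dfa_lang (A_delta S i)) = confusable S (delta i) w.
Proof.
move=> init_neq0.
(* All states of the automaton are final, so acceptance only asks that the run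
   be defined. *)
have -> : (w \in dfa_lang (A_delta S i)) = dfa_run (dfa_init (A_delta S i)) w.
  rewrite -topredE /= /dfa_lang.
  by case: (dfa_run _ _) => //= s; rewrite inE.
apply/A_delta_runP/confusableP; by [exact: init_sub | ].
Qed.

End Automaton.

Theorem mainTheorem1 (n m q : nat) (hn : (0 < n)%N) (hm : (0 < m)%N)
    (hq : (0 < q)%N) (S : bcn n m q) :
  ~ type1_observable S <->
  exists i : 'I_(2 ^ n),
    (exists v : {set Delta (2 ^ n)},
       v \in vertices S /\ ~~ diagonal v /\ delta i \in v) /\
    recognizes (A_delta S i) predT.
Proof.
rewrite type1_observableP; split.
  case/not_all_ex_not=> x nsep; have [i ei] := delta_surj x; subst x.
  have conf w : confusable S (delta i) w.
    by apply: contraT => sepw; case: nsep; exists w.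
  have init_neq0 := confusable_init (conf [::]).
  exists i; split; first exact/init_neq0P.
  by move=> w; rewrite A_delta_lang // conf.
case=> i [/init_neq0P init_neq0 rec] /(_ (delta i))[w].
by rewrite -(A_delta_lang w init_neq0) rec.
Qed.
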